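(* Let $X$ be a finite set of $n$ points in the plane and let $d$ be the $L_1$ metric restricted to $X$, i.e. $d((u_1,u_2),(v_1,v_2))=|u_1-v_1|+|u_2-v_2|$. Then in the metric space $(X,d)$ either there is a line that contains all points of $X$, or there are at least $n/37$ distinct lines.
   Context: In a metric space $(V,\rho)$, a point $x$ is between $a$ and $b$, written $[axb]$, if $\rho(a,b)=\rho(a,x)+\rho(x,b)$. For distinct $a,b\in V$, the line determined by $a$ and $b$ is $\langle a,b\rangle=\{x\in V:[xab]\}\cup\{a\}\cup\{x\in V:[axb]\}\cup\{b\}\cup\{x\in V:[abx]\}$. Lines are compared as subsets of $V$; ''distinct lines'' means distinct sets of this form.
   Formalization: The formal statement assumes n ≥ 2; for n = 1 the claim as written fails, since a single point determines no line and 0 < 1/37 (the trivial case n = 0 is also excluded). *)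

(* Defs.v *)
From HB Require Import structures.
From mathcomp Require Import all_boot all_order all_algebra finmap reals.

Set Implicit Arguments.
Unset Strict Implicit.
Unset Printing Implicit Defensive.

Import Order.TTheory GRing.Theory Num.Theory.
Local Open Scope ring_scope.

Definition is_metric (R : realType) (V : Type) (rho : V -> V -> R) : Prop :=
  [/\ forall x y, 0 <= rho x y,
      forall x y, rho x y = 0 <-> x = y,
      forall x y, rho x y = rho y x &
      forall x y z, rho x z <= rho x y + rho y z].

Definition between (R : realType) (V : Type) (rho : V -> V -> R) (a x b : V)
  : bool := rho a b == rho a x + rho x b.

Definition line (R : realType) (V : finType) (rho : V -> V -> R) (a b : V)
  : {set V} :=
  [set x | [|| between rho x a b, x == a, between rho a x b, x == b
             | between rho a b x]].

(* Lines are extensional sets, so the cardinal of [lines rho] counts distinct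
   lines, however many pairs of points determine them. *)
Definition lines (R : realType) (V : finType) (rho : V -> V -> R)
  : {set {set V}} :=
  [set line rho p.1 p.2 | p : V * V & p.1 != p.2].

Definition l1_dist (R : realType) (u v : R * R) : R :=
  `|u.1 - v.1| + `|u.2 - v.2|.

(* A finite set [X : {fset R * R}] coerces to the finite type of its points,
   which is the carrier of the metric space. *)
Definition l1_on (R : realType) (X : {fset R * R}) (u v : X) : R :=
  l1_dist (val u) (val v).

Lemma l1_on_metric (R : realType) (X : {fset R * R}) : is_metric (@l1_on R X).
Proof.
rewrite /l1_on /l1_dist; split=> [x y|x y|x y|x y z].
- by rewrite addr_ge0.
- split=> [/eqP|->]; last by rewrite !subrr normr0 addr0.
  rewrite paddr_eq0 ?normr_ge0 // !normr_eq0 !subr_eq0 => /andP[/eqP h1 /eqP h2].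
  by apply: val_inj; rewrite [LHS]surjective_pairing [RHS]surjective_pairing h1 h2.
- by rewrite distrC (distrC (val x).2).
- by rewrite addrACA lerD // ler_distD.
Qed.

(* Main.v *)
Require Import Defs.
From HB Require Import structures.
From mathcomp Require Import all_boot all_order all_algebra finmap reals.
From mathcomp Require Import zify lra.

(* Only the order of the coordinates matters, so they are replaced by natural
   numbers; [inc] and [dec] are the two closed comparabilities of points of the
   plane.  If q and a are not [inc]-related, their line is the set of points
   [dec]-related to both, and symmetrically.  Let k be the number of lines, and
   assume that none is universal.

   Let p be the lowest point of the leftmost column.  The points a strictly
   northeast of p are grouped by their line with p, that is by the set of points
   z with y p <= y z that are [inc]-related to a.  This gives at most k classes,
   which are chains, and they do not contain two points of a column since some
   point lies strictly between their rows.  At most k points have a classmate to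
   their right in their row, and at most 2k more are the top or the bottom of
   their class.  The others are mapped to their line with q, where q is
   extremal among the points of height at least y p that are not [inc]-related
   to the class ([left_end] if some lie to the left, [right_end] otherwise), or
   any point below p to the right of a if there are none ([low_end]).  Each of
   the three maps is injective, because the line of q and a meets the class of a
   in a alone and q is extremal.  Hence at most 6k points lie northeast of p,
   and likewise at most 6k lie southeast of the highest point of the leftmost
   column.  A row or a column has at most k + 1 points, so that
   n <= 14k + 2 <= 37k. *)

Set Implicit Arguments.
Unset Strict Implicit.
Unset Printing Implicit Defensive.

Import Order.TTheory GRing.Theory Num.Theory.

Definition natbetween (u v w : nat) := (u <= v <= w) || (w <= v <= u).

Lemma lexmin (V : finType) (P : pred V) (f g : V -> nat) w : P w ->
  exists2 q, P q & forall v, P v -> (f q < f v) || (f q == f v) && (g q <= g v).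
Proof.
move=> Pw; case: (arg_minnP f Pw) => u Pu umin.
have Qu : [pred v | P v & f v == f u] u by rewrite /= Pu eqxx.
case: (arg_minnP g Qu) => q /andP[Pq /eqP fq] qmin; exists q => // v Pv.
by have := umin v Pv; have := qmin v; rewrite /= Pv fq; lia.
Qed.

(** * Lines over natural coordinates, and how they are counted *)

Section Lines.
Variables (V : finType) (x y : V -> nat).

Definition in_box a z b :=
  natbetween (x a) (x z) (x b) && natbetween (y a) (y z) (y b).

Lemma in_boxl a b : in_box a a b.
Proof. by rewrite /in_box /natbetween; lia. Qed.

Lemma in_boxr a b : in_box a b b.
Proof. by rewrite /in_box /natbetween; lia. Qed.

Definition box_line a b :=
  [set z | [|| in_box z a b, in_box a z b | in_box a b z]].

Definition box_lines := [set box_line p.1 p.2 | p : V * V & p.1 != p.2].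

(** Each count below sends [a] to its line with some [q]. Injectivity is asked for all [q] allowed
    by [P], so that the choice of [q] does not matter. *)
Lemma card_le_box_lines (S : {set V}) (P : rel V) :
    (forall a, a \in S -> exists2 q, q != a & P q a) ->
    {in S &, forall a b q r,
      P q a -> P r b -> box_line q a = box_line r b -> a = b} ->
  #|S| <= #|box_lines|.
Proof.
move=> Pex Pinj; pose g a := odflt a [pick q | (q != a) && P q a].
have gP a : a \in S -> (g a != a) && P (g a) a.
  move=> /Pex[q qa Pqa]; rewrite /g; case: pickP => //= /(_ q).
  by rewrite qa Pqa.
rewrite -(@card_in_imset _ _ (fun a => box_line (g a) a)); last first.
  move=> a b aS bS; have [/andP[_ Pa] /andP[_ Pb]] := (gP a aS, gP b bS).
  exact: Pinj Pa Pb.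
apply/subset_leq_card/subsetP=> _ /imsetP[a aS ->]; apply/imsetP.
by exists (g a, a); rewrite // inE; have /andP[] := gP a aS.
Qed.

(** * Neighbouring rows and columns when no line is universal *)

Hypothesis xy_inj : forall a b, x a = x b -> y a = y b -> a = b.
Hypothesis no_universal : forall a b, a != b -> exists z, z \notin box_line a b.

(* A point of the row of [a] and of the next column would generate a universal
   line with [a]. *)
Lemma next_col a b : x a < x b ->
  exists z, [/\ x a < x z, y z != y a & forall w, x a < x w -> x z <= x w].
Proof.
move=> ab; case: (arg_minnP x (P := [pred z | x a < x z]) ab) => z /= az zmin.
exists z; split=> //; apply/eqP => yaz.
have [|w] := @no_universal a z; first by apply: contraTneq az => ->; rewrite ltnn.
have := zmin w; rewrite !inE /in_box /natbetween; lia.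
Qed.

Lemma next_row a b : y a < y b ->
  exists z, [/\ y a < y z, x z != x a & forall w, y a < y w -> y z <= y w].
Proof.
move=> ab; case: (arg_minnP y (P := [pred z | y a < y z]) ab) => z /= az zmin.
exists z; split=> //; apply/eqP => yaz.
have [|w] := @no_universal a z; first by apply: contraTneq az => ->; rewrite ltnn.
have := zmin w; rewrite !inE /in_box /natbetween; lia.
Qed.

Lemma col_between a b : y a = y b -> x a < x b -> exists z,
  [/\ x a < x z < x b, y z != y a & forall w, x a < x w -> x z <= x w].
Proof.
move=> yab ab; have [z [az yz zmin]] := next_col ab; exists z; split=> //.
have zb := zmin _ ab; rewrite az ltn_neqAle zb andbT; apply/eqP => xzb.
have [|v] := @no_universal a b; first by apply: contraTneq ab => ->; rewrite ltnn.
by have := zmin v; rewrite !inE /in_box /natbetween; lia.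
Qed.

Lemma row_between a b : x a = x b -> y a < y b -> exists z,
  y a < y z < y b /\ x z != x a.
Proof.
move=> xab ab; have [z [az xz zmin]] := next_row ab; exists z; split=> //.
have zb := zmin _ ab; rewrite az ltn_neqAle zb andbT; apply/eqP => yzb.
have [|v] := @no_universal a b; first by apply: contraTneq ab => ->; rewrite ltnn.
by have := zmin v; rewrite !inE /in_box /natbetween; lia.
Qed.

(** Each point but the rightmost [m] goes to its line with [m]. For [a] left of [b], a point [z] off
    the row, in the column after that of [a], is on the line of [m] and [b] but not on that of [m]
    and [a]. *)
Lemma row_card p : #|[set z | y z == y p]| <= #|box_lines|.+1.
Proof.
case: (arg_maxnP x (P := [pred z | y z == y p]) (eqxx _)) => m /= /eqP ym mmax.
rewrite (cardsD1 m) inE ym eqxx add1n ltnS.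
apply: (@card_le_box_lines _ (fun q _ => q == m)) => [a|a b].
  by rewrite !inE => /andP[am _]; exists m; rewrite // eq_sym.
rewrite !inE => /andP[/eqP am /eqP ya] /andP[/eqP bm /eqP yb] q r.
move=> /eqP -> /eqP -> e.
wlog ab : a b am bm ya yb e / x a < x b.
  move=> H; case: (ltngtP (x a) (x b)) => [lt|gt|eq]; first exact: H.
    exact/esym/H.
  by apply: xy_inj; rewrite // ya.
have bm' : x b <= x m by apply: mmax; rewrite /= yb.
have [z [az yz zmin]] := next_col ab; have zb := zmin _ ab.
have zm : x z = x m -> False.
  by move=> zm; apply: bm; apply: xy_inj; lia.
by have /setP/(_ z) := e; rewrite !inE /in_box /natbetween; lia.
Qed.

(** * The two comparabilities *)

Definition inc z a :=
  (x z <= x a) && (y z <= y a) || (x a <= x z) && (y a <= y z).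

(** Two points are always related by [inc] or [dec], and by both exactly when they share a row or a
    column. *)
Definition dec z a :=
  (x z <= x a) && (y a <= y z) || (x a <= x z) && (y z <= y a).

Lemma mem_box_line_ninc q a z : ~~ inc q a ->
  (z \in box_line q a) = dec z q && dec z a.
Proof. by rewrite !inE /in_box /natbetween /inc /dec; lia. Qed.

Lemma box_line_ninc_dec q a b r : ~~ inc q a -> ~~ inc r b ->
  box_line q a = box_line r b ->
  [&& dec q r, dec q b, dec a r & dec a b].
Proof.
move=> qa rb /setP e; have := e q; have := e a; rewrite !mem_box_line_ninc //.
by move: qa; rewrite /inc /dec; lia.
Qed.

(** * Classes of the points northeast of the pivot [p] *)

Variable p : V.
Hypothesis p_left : forall z, x p <= x z.
Hypothesis p_low : forall z, x z = x p -> y p <= y z.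

Definition northeast a := (x p < x a) && (y p < y a).
(** As [p] and [a] are not [dec]-related, their line is the set of points [inc]-related to both;
    those at height at least [y p] are all [inc]-related to [p]. *)
Lemma box_line_pivot a z : northeast a -> y p <= y z ->
  (z \in box_line p a) = inc z a.
Proof.
have := p_left z; have := @p_low z.
by rewrite !inE /in_box /natbetween /northeast /inc; lia.
Qed.

Definition twin a b :=
  [&& northeast a, northeast b & box_line p a == box_line p b].

Lemma twinC a b : twin a b = twin b a.
Proof. by rewrite /twin eq_sym andbCA. Qed.

Lemma twin_inc a b z : twin a b -> y p <= y z -> inc z a = inc z b.
Proof. by move=> /and3P[Na Nb /eqP e] pz; rewrite -!box_line_pivot // e. Qed.

Lemma twinP a b : northeast a -> northeast b ->
  (forall z, y p <= y z -> inc z a = inc z b) -> twin a b.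
Proof.
move=> Na Nb H; apply/and3P; split=> //; apply/eqP/setP => z.
have [pz|zp] := leqP (y p) (y z); first by rewrite !box_line_pivot ?H.
(* A point below [p] is strictly right of it, hence on neither line. *)
have := @p_low z; move: Na Nb zp (p_left z).
by rewrite !inE /in_box /natbetween /northeast; lia.
Qed.

Lemma twin_col a b : twin a b -> x a = x b -> a = b.
Proof.
wlog ab : a b / y a < y b => [H|] tw xab.
  case: (ltngtP (y a) (y b)) => [lt|gt|eq]; first exact: H.
    by apply/esym/H; rewrite // twinC.
  exact: xy_inj.
have [z [zab xz]] := row_between xab ab.
have /and3P[Na Nb _] := tw.
have := twin_inc (z := z) tw; move: Na Nb; rewrite /inc /northeast; lia.
Qed.

Definition right_twin a := [exists b, [&& twin a b, y a == y b & x a < x b]].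

Lemma card_right_twin : #|[set a | right_twin a]| <= #|box_lines|.
Proof.
apply: (@card_le_box_lines _
  (fun q a => [&& twin a q, y a == y q & x a < x q])).
  move=> a; rewrite inE => /existsP[b H]; exists b => //.
  by case/and3P: H => _ _; apply: contraTneq => ->; rewrite ltnn.
move=> a b _ _ q r /and3P[twq /eqP yq xq] /and3P[twr /eqP yr xr] e.
wlog: a b q r twq yq xq twr yr xr e /
  (x a < x b) || (x a == x b) && (y a < y b).
  move=> H; have [lt|lt|xab] := ltngtP (x a) (x b).
  - by apply: (H a b q r) => //; rewrite lt.
  - by apply/esym/(H b a r q) => //; rewrite lt.
  have [lt|lt|yab] := ltngtP (y a) (y b).
  - by apply: (H a b q r) => //; rewrite xab lt eqxx orbT.
  - by apply/esym/(H b a r q) => //; rewrite xab lt eqxx orbT.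
  exact: xy_inj.
case/orP => [ab|/andP[/eqP ab yab]].
  (* [z] is off the row of [a] and strictly between the columns of [a] and [q], so off their line;
     not being right of [b], it is on the line of [r] and [b]. *)
  have [z [zaq yz zmin]] := col_between yq xq; have zb := zmin _ ab.
  by have /setP/(_ z) := e; rewrite !inE /in_box /natbetween; lia.
(* Now [b] is straight above [a]: it is [inc]-related to [a] but not to its classmate [q]. *)
have /and3P[Na Nb _] := twr.
by have := twin_inc (z := b) twq; move: Na Nb xq; rewrite /inc /northeast; lia.
Qed.

(** [a] is [inc]-related to itself, hence to [b]; [twin_col] and the lack of right twins make this
    strict. *)
Lemma twin_chain a b : twin a b -> ~~ right_twin a -> ~~ right_twin b ->
  a != b -> (x a < x b) && (y a < y b) || (x b < x a) && (y b < y a).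
Proof.
move=> tw aT bT ab.
have xab : x a <> x b by move=> /(twin_col tw) e; rewrite e eqxx in ab.
have tw' : twin b a by rewrite twinC.
have := twin_inc (z := a) tw; have /and3P[Na Nb _] := tw.
have : y a <> y b.
  move=> yab; move: aT bT.
  case: (ltngtP (x a) (x b)) => // lt.
    by move=> /existsP[]; exists b; rewrite tw yab eqxx.
  by move=> _ /existsP[]; exists a; rewrite tw' yab eqxx.
move: Na Nb; rewrite /inc /northeast; lia.
Qed.

Definition above a := [exists b, [&& twin a b, x a < x b & y a < y b]].
Definition below a := [exists b, [&& twin a b, x b < x a & y b < y a]].

Lemma card_top :
  #|[set a | [&& northeast a, ~~ right_twin a & ~~ above a]]| <= #|box_lines|.
Proof.
apply: (@card_le_box_lines _ (fun q _ => q == p)).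
  move=> a; rewrite inE => /and3P[Na _ _]; exists p => //.
  by apply: contraTneq Na => <-; rewrite /northeast ltnn.
move=> a b; rewrite !inE => /and3P[Na aT na] /and3P[Nb bT nb] q r.
move=> /eqP -> /eqP -> e.
apply/eqP; apply/negPn/negP => ab.
have tw : twin a b by rewrite /twin Na Nb e eqxx.
case/orP: (twin_chain tw aT bT ab) => H.
  by case/existsP: na; exists b; rewrite tw.
by case/existsP: nb; exists a; rewrite twinC tw.
Qed.

Lemma card_bottom :
  #|[set a | [&& northeast a, ~~ right_twin a & ~~ below a]]| <= #|box_lines|.
Proof.
apply: (@card_le_box_lines _ (fun q _ => q == p)).
  move=> a; rewrite inE => /and3P[Na _ _]; exists p => //.
  by apply: contraTneq Na => <-; rewrite /northeast ltnn.
move=> a b; rewrite !inE => /and3P[Na aT na] /and3P[Nb bT nb] q r.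
move=> /eqP -> /eqP -> e.
apply/eqP; apply/negPn/negP => ab.
have tw : twin a b by rewrite /twin Na Nb e eqxx.
case/orP: (twin_chain tw aT bT ab) => H.
  by case/existsP: nb; exists a; rewrite twinC tw.
by case/existsP: na; exists b; rewrite tw.
Qed.


(** * Inner points and their ends *)

Definition inner a := [&& northeast a, ~~ right_twin a, above a & below a].

Lemma inner_twin a b : inner a -> inner b -> twin a b -> a != b ->
  (x a < x b) && (y a < y b) || (x b < x a) && (y b < y a).
Proof. by move=> /and4P[_ aT _ _] /and4P[_ bT _ _] tw; apply: twin_chain. Qed.

Definition left_end q a :=
  [&& y p <= y q, ~~ inc q a, x q < x a & [forall w,
     (y p <= y w) && ~~ inc w a ==>
     ((x q < x w) || (x q == x w) && (y q <= y w))]].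

(** Points not [inc]-related to [a] are northwest or southeast of it, so left ends are extremal
    westward and right ends southward. The condition [x a < x w] rules out northwest ones. *)
Definition right_end q a :=
  [&& y p <= y q, ~~ inc q a & [forall w,
     (y p <= y w) && ~~ inc w a ==>
     ((x a < x w) && ((y q < y w) || (y q == y w) && (x q <= x w)))]].

Definition low_end q a :=
  [&& y q < y p, x a < x q & [forall w, (y p <= y w) ==> inc w a]].


(** Minimality of [r] makes [q] [inc]-related to [b]. It is also [dec]-related to [b], so it is in
    the row of [b], and then in the column of [r]. A lower classmate [b'] of [b] is not right of
    [q], hence is [inc]-related to [r], unlike [b]. *)
Lemma left_end_inj_neq a b q r : inner a -> inner b ->
  left_end q a -> left_end r b -> box_line q a = box_line r b -> q != r ->
  (x q < x r) || (x q == x r) && (y q <= y r) -> False.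
Proof.
move=> /and4P[Na _ _ _] /and4P[Nb _ _ /existsP[b' /and3P[tw xb yb]]].
move=> /and4P[pq qa xqa /forallP qmin] /and4P[pr rb xrb /forallP rmin] e qr lex.
have yrb : y b < y r by move: rb xrb; rewrite /inc; lia.
have nqr : x q = x r -> y q = y r -> False.
  by move=> ? ?; apply/negP/negPn: qr; apply/eqP/xy_inj.
have {}qb : inc q b.
  by apply/negPn/negP => qb; have := rmin q; rewrite pq qb; move: lex; lia.
have /and4P[dqr dqb _ _] := box_line_ninc_dec qa rb e.
have [yqb xqr] : y q = y b /\ x q = x r.
  by move: dqr dqb qb; rewrite /inc /dec; lia.
have := twin_inc tw pq; have := twin_inc tw pr.
by move: rb qb; rewrite /inc; lia.
Qed.

(** The same with rows and columns exchanged: [q] is straight below [b], in the row of [r]. *)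
Lemma right_end_inj_neq a b q r : inner a -> inner b ->
  right_end q a -> right_end r b -> box_line q a = box_line r b -> q != r ->
  (y q < y r) || (y q == y r) && (x q <= x r) -> False.
Proof.
move=> /and4P[Na _ _ _] /and4P[Nb _ _ /existsP[b' /and3P[tw xb yb]]].
move=> /and3P[pq qa /forallP qmin] /and3P[pr rb /forallP rmin] e qr lex.
have [xbr yrb] : x b < x r /\ y r < y b.
  by have := rmin r; rewrite pr rb; move: rb; rewrite /inc; lia.
have nqr : x q = x r -> y q = y r -> False.
  by move=> ? ?; apply/negP/negPn: qr; apply/eqP/xy_inj.
have {}qb : inc q b.
  by apply/negPn/negP => qb; have := rmin q; rewrite pq qb; move: lex; lia.
have /and4P[dqr dqb _ _] := box_line_ninc_dec qa rb e.
have [xqb yqr] : x q = x b /\ y q = y r.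
  by move: dqr dqb qb; rewrite /inc /dec; lia.
have := twin_inc tw pq; have := twin_inc tw pr.
by move: rb qb; rewrite /inc; lia.
Qed.

(* If [a] and [b] are not [inc]-related, then [b] and a classmate [a'] of [a]
   are not [inc]-related either, so that [a'] is on the line of [q] and [b] but not
   on that of [q] and [a]. *)
Lemma same_end_inc a b q : inner a -> northeast b -> y p <= y q ->
  ~~ inc q a -> ~~ inc q b -> box_line q a = box_line q b -> inc a b.
Proof.
move=> /and4P[_ _ /existsP[a' /and3P[tw xa ya]] _] /andP[_ /ltnW pb] pq qa qb e.
apply/negPn/negP => ab; have /setP/(_ a') := e; rewrite !mem_box_line_ninc //.
have := twin_inc tw pb; have := twin_inc tw pq.
by move: qa qb ab; rewrite /inc /dec; lia.
Qed.

(** [z] is [dec]-related to just one of [a] and [b], hence not to [q], so it is left of [q]. As it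
    is not [inc]-related to [a], this contradicts the minimality of [q]. *)
Lemma left_end_inj_col a b q : inner a -> inner b ->
  left_end q a -> left_end q b -> box_line q a = box_line q b ->
  x a = x b -> y a < y b -> False.
Proof.
move=> ga gb /and4P[pq qa xqa /forallP qmin] /and4P[_ qb _ _] e xab yab.
have /and4P[/andP[_ pa] _ _ _] := ga.
have [z [zab xz]] := row_between xab yab.
have /setP/(_ z) := e; rewrite !mem_box_line_ninc //; have := qmin z.
by move: qa qb; rewrite /inc /dec; lia.
Qed.

(** [z] is [dec]-related to just one of [a] and [b], hence not to [q], so it is above [q]. An upper
    classmate [a'] of [a] is off both lines, so right of [b]; as [z] is [inc]-related to [a'], it is
    not above [a']. Then [q] is [inc]-related to [a'] but not to [a]. *)
Lemma left_end_inj_row a b q : inner a -> inner b ->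
  left_end q a -> left_end q b -> box_line q a = box_line q b ->
  y a = y b -> x a < x b -> False.
Proof.
move=> ga gb /and4P[pq qa xqa _] /and4P[_ qb xqb _] e yab xab.
have /and4P[Na _ /existsP[a' /and3P[tw xa ya]] _] := ga.
have [z [/andP[xaz xzb] yz _]] := col_between yab xab.
have yaq : y a < y q by move: qa xqa; rewrite /inc; lia.
have yqz : y q < y z.
  have /setP/(_ z) := e; rewrite !mem_box_line_ninc // /dec.
  by move: yz xqa xqb xaz xzb yaq yab; clear; lia.
have pz : y p <= y z by move: pq yqz; lia.
have /setP/(_ a') := e; rewrite !mem_box_line_ninc //.
have := twin_inc tw pz; have := twin_inc tw pq.
by move: qa; rewrite /inc /dec; lia.
Qed.

(** The mirror image of [left_end_inj_row] in the diagonal. *)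
Lemma right_end_inj_col a b q : inner a -> inner b ->
  right_end q a -> right_end q b -> box_line q a = box_line q b ->
  x a = x b -> y a < y b -> False.
Proof.
move=> ga gb /and3P[pq qa /forallP qmin] /and3P[_ qb _] e xab yab.
have /and4P[Na _ /existsP[a' /and3P[tw xa ya]] _] := ga.
have [z [/andP[yaz yzb] xz]] := row_between xab yab.
have [xaq yqa] : x a < x q /\ y q < y a.
  by have := qmin q; rewrite pq qa; move: qa; rewrite /inc; lia.
have xqz : x q < x z.
  have /setP/(_ z) := e; rewrite !mem_box_line_ninc // /dec.
  by move: xz xaq yqa yaz yzb xab; clear; lia.
have pz : y p <= y z by move: pq yqa yaz; lia.
have /setP/(_ a') := e; rewrite !mem_box_line_ninc //.
have := twin_inc tw pz; have := twin_inc tw pq.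
by move: qa; rewrite /inc /dec; lia.
Qed.

Lemma right_end_inj_row a b q : inner a -> inner b ->
  right_end q a -> right_end q b -> box_line q a = box_line q b ->
  y a = y b -> x a < x b -> False.
Proof.
move=> ga gb /and3P[pq qa /forallP amin] /and3P[_ qb /forallP bmin] e yab xab.
have /and4P[Na _ /existsP[a' /and3P[tw xa ya]] _] := ga.
have /and4P[Nb _ _ _] := gb.
have [xbq yqb] : x b < x q /\ y q < y b.
  by have := bmin q; rewrite pq qb; move: qb; rewrite /inc; lia.
have xba' : x b < x a'.
  have /setP/(_ a') := e; rewrite !mem_box_line_ninc //.
  by have := twin_inc tw pq; move: qa; rewrite /inc /dec; lia.
(* By minimality of [q], a point telling [a] from [b] is below their row and on the line of [q] and
   [a]. Being also on that of [q] and [b], it is straight below [b], hence [inc]-related to [a'] but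
   not to [a]. *)
have : twin a b.
  apply: twinP => // z pz; have := amin z; have := bmin z; rewrite pz /=.
  have /setP/(_ z) := e; rewrite !mem_box_line_ninc //; have := twin_inc tw pz.
  by rewrite /inc /dec; move: xba' xbq yqb yab xab ya; clear; lia.
move/(inner_twin ga gb) => H; have := H _; rewrite yab ltnn !andbF.
by move=> /(_ (contraTneq _ xab)) F; apply: notF; apply: F => ->; rewrite ltnn.
Qed.

(** All points at height at least [y p] are [inc]-related to both [a] and [b], which are thus
    classmates; being [dec]-related, they do not form a strict chain. *)
Lemma low_end_inj a b q r : inner a -> inner b ->
  low_end q a -> low_end r b -> box_line q a = box_line r b -> a = b.
Proof.
move=> ga gb /and3P[yq xq /forallP aU] /and3P[yr xr /forallP bU] e.
have /and4P[Na _ _ _] := ga; have /and4P[Nb _ _ _] := gb.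
have [qa rb] : ~~ inc q a /\ ~~ inc r b.
  by move: Na Nb yq xq yr xr; rewrite /northeast /inc; lia.
have /and4P[_ _ _ dab] := box_line_ninc_dec qa rb e.
have tw : twin a b.
  by apply: twinP => // z pz; have := aU z; have := bU z; rewrite pz /= => -> ->.
apply/eqP/negPn/negP => /(inner_twin ga gb tw).
by move: dab; rewrite /dec; lia.
Qed.

Lemma inner_end a : inner a ->
  [|| [exists q, left_end q a], [exists q, right_end q a]
    | [exists q, low_end q a]].
Proof.
move=> ga; pose M := [pred w | (y p <= y w) && ~~ inc w a].
have [[w /andP[/andP[Mw1 Mw2] xw]]|noleft] :=
    altP (existsP (P := [pred w | M w && (x w < x a)])).
  have [|q /andP[pq qa] qmin] := @lexmin _ M x y w; first exact/andP.
  apply/orP; left; apply/existsP; exists q; apply/and4P; split=> //.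
    by have := qmin w; rewrite /= Mw1 Mw2; lia.
  by apply/forallP => v; apply/implyP; apply: qmin.
have [[w Mw]|noM] := altP (existsP (P := M)).
  have [q /andP[pq qa] qmin] := @lexmin _ M y x w Mw.
  apply/or3P/Or32/existsP; exists q; apply/and3P; split=> //.
  apply/forallP => v; apply/implyP => Mv; rewrite (qmin _ Mv) andbT.
  have vl : ~~ (x v < x a).
    by apply: contra noleft => xv; apply/existsP; exists v; rewrite /= xv andbT.
  by case/andP: Mv vl => _; rewrite /inc; lia.
apply/or3P/Or33.
have incU z : y p <= y z -> inc z a.
  move=> pz; apply/negPn/negP => za; case/existsP: noM; exists z.
  by rewrite /= pz za.
have /and4P[Na _ /existsP[a' /and3P[tw xa ya]] _] := ga.
(* Points at height at least [y p] are [inc]-related to [a] and [a'], so on their line; a point off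
   it is below [p]. *)
have [|z] := @no_universal a a'; first by apply: contraTneq xa => <-; rewrite ltnn.
move=> zaa'; apply/existsP; exists z.
have yzp : y z < y p.
  rewrite ltnNge; apply/negP => pz; have za := incU z pz.
  have := twin_inc tw pz; move: za zaa'; rewrite !inE /in_box /natbetween /inc; lia.
apply/and3P; split=> //; last by apply/forallP => w; apply/implyP/incU.
by move: zaa' Na; rewrite !inE /in_box /natbetween /northeast; lia.
Qed.

(** [f] and [g] are the coordinates in the order used by the minimality of the end. If [q] and [r]
    agree, [a] and [b] are both [inc]- and [dec]-related, so share a row or a column. *)
Lemma end_inj (E : rel V) (f g : V -> nat) :
    (forall q a, E q a -> (y p <= y q) && ~~ inc q a) ->
    (forall a b q r, inner a -> inner b -> E q a -> E r b ->
      box_line q a = box_line r b ->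
      q != r -> (f q < f r) || (f q == f r) && (g q <= g r) -> False) ->
    (forall a b q, inner a -> inner b -> E q a -> E q b ->
      box_line q a = box_line q b ->
      x a = x b -> y a < y b -> False) ->
    (forall a b q, inner a -> inner b -> E q a -> E q b ->
      box_line q a = box_line q b ->
      y a = y b -> x a < x b -> False) ->
  forall a b q r, inner a -> inner b -> E q a -> E r b ->
      box_line q a = box_line r b ->
  a = b.
Proof.
move=> EP neq col row a b q r ga gb Eq Er e.
have /andP[pq qa] := EP _ _ Eq; have /andP[pr rb] := EP _ _ Er.
have [qr|qr] := eqVneq q r; last first.
  have [lex|nlex] := boolP ((f q < f r) || (f q == f r) && (g q <= g r)).
    by case: (neq a b q r).
  have /(neq b a r q gb ga Er Eq (esym e)) [] : r != q by rewrite eq_sym.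
  by move: nlex; lia.
subst r; have /and4P[Nb _ _ _] := gb.
have cab := same_end_inc ga Nb pq qa rb e.
have /and4P[_ _ _ dab] := box_line_ninc_dec qa rb e.
have [yab|yab|yab] := ltngtP (y a) (y b).
- have xab : x a = x b by move: cab dab; rewrite /inc /dec; lia.
  by case: (col a b q).
- have xab : x b = x a by move: cab dab; rewrite /inc /dec; lia.
  by case: (col b a q).
have [xab|xab|xab] := ltngtP (x a) (x b); last exact: xy_inj.
- by case: (row a b q).
- by case: (row b a q).
Qed.

Lemma card_end (E : rel V) :
    (forall q a, E q a -> q != a) ->
    (forall a b q r, inner a -> inner b -> E q a -> E r b ->
      box_line q a = box_line r b ->
      a = b) ->
  #|[set a | inner a & [exists q, E q a]]| <= #|box_lines|.
Proof.
move=> Eneq Einj; apply: (@card_le_box_lines _ E) => [a|a b].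
  by rewrite inE => /andP[_ /existsP[q Eq]]; exists q; rewrite ?(Eneq q).
rewrite !inE => /andP[ga _] /andP[gb _] q r; exact: Einj.
Qed.

Lemma quadrant_card : #|[set a | northeast a]| <= 6 * #|box_lines|.
Proof.
have incxx a : inc a a by rewrite /inc !leqnn.
have cardL : #|[set a | inner a & [exists q, left_end q a]]| <= #|box_lines|.
  apply: card_end => [q a /and4P[_ qa _ _]|].
    by apply: contraNneq qa => ->.
  apply: (@end_inj _ x y) => [q a /and4P[-> -> //]|||].
  - exact: left_end_inj_neq.
  - exact: left_end_inj_col.
  - exact: left_end_inj_row.
have cardR : #|[set a | inner a & [exists q, right_end q a]]| <= #|box_lines|.
  apply: card_end => [q a /and3P[_ qa _]|].
    by apply: contraNneq qa => ->.
  apply: (@end_inj _ y x) => [q a /and3P[-> -> //]|||].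
  - exact: right_end_inj_neq.
  - exact: right_end_inj_col.
  - exact: right_end_inj_row.
have cardZ : #|[set a | inner a & [exists q, low_end q a]]| <= #|box_lines|.
  apply: card_end => [q a /and3P[_ xqa _]|]; last exact: low_end_inj.
  by apply: contraTneq xqa => ->; rewrite ltnn.
have := card_right_twin; have := card_top; have := card_bottom.
move: cardL cardR cardZ.
set A1 := [set a | _]; set A2 := [set a | _]; set A3 := [set a | _].
set A4 := [set a | _]; set A5 := [set a | _]; set A6 := [set a | _].
move=> c1 c2 c3 c4 c5 c6.
have sub : [set a | northeast a] \subset A1 :|: A2 :|: A3 :|: A4 :|: A5 :|: A6.
  apply/subsetP=> a; rewrite !inE => Na; rewrite Na /=.
  have [|rt /=] := boolP (right_twin a); first by rewrite orbT.
  have [ab|] := boolP (above a); last by rewrite !orbT.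
  have [be|] := boolP (below a); last by rewrite !orbT.
  have ga : inner a by apply/and4P.
  by rewrite ga /=; case/or3P: (inner_end ga) => ->; rewrite ?orbT.
have cardU := fun A B : {set V} => leq_of_leqif (leq_card_setU A B).
apply: leq_trans (subset_leq_card sub) _.
have := cardU (A1 :|: A2 :|: A3 :|: A4 :|: A5) A6.
have := cardU (A1 :|: A2 :|: A3 :|: A4) A5.
have := cardU (A1 :|: A2 :|: A3) A4.
have := cardU (A1 :|: A2) A3; have := cardU A1 A2; lia.
Qed.

End Lines.

(** * Symmetries and the global count *)

Lemma eq_box_lines (V : finType) (x y x' y' : V -> nat) :
  (forall a b, box_line x y a b = box_line x' y' a b) ->
  box_lines x y = box_lines x' y'.
Proof. by move=> e; apply: eq_imset => q; apply: e. Qed.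

Lemma box_lineC (V : finType) (x y : V -> nat) a b :
  box_line y x a b = box_line x y a b.
Proof.
by apply/setP => z; rewrite !inE /in_box ![natbetween (y _) _ _ && _]andbC.
Qed.

(** The bound [K] keeps the truncated subtraction from merging rows. *)
Lemma box_line_flip (V : finType) (x y : V -> nat) K a b :
    (forall z, y z <= K) ->
  box_line x (fun z => K - y z) a b = box_line x y a b.
Proof.
move=> yK; have betweenK u v w :
    natbetween (K - y u) (K - y v) (K - y w) = natbetween (y u) (y v) (y w).
  by have := yK u; have := yK v; have := yK w; rewrite /natbetween; lia.
by apply/setP => z; rewrite !inE /in_box !betweenK.
Qed.

Lemma card_le_lines (V : finType) (x y : V -> nat) (p0 : V) :
    (forall a b, x a = x b -> y a = y b -> a = b) ->
    (forall a b, a != b -> exists z, z \notin box_line x y a b) ->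
  #|V| <= 14 * #|box_lines x y| + 2.
Proof.
move=> xy_inj nouniv.
have [p _ pmin] := @lexmin V predT x y p0 isT.
have p_left z : x p <= x z by have := pmin z isT; lia.
have p_low z : x z = x p -> y p <= y z by have := pmin z isT; lia.
pose K := \max_z y z; pose y' z := K - y z.
have yK z : y z <= K by apply: leq_bigmax.
(* [q] is the highest point of the leftmost column. *)
have [q _ qmin] := @lexmin V predT x y' p0 isT.
have q_left z : x q <= x z by have := qmin z isT; lia.
have q_low z : x z = x q -> y' q <= y' z by have := qmin z isT; lia.
have yx_inj a b : y a = y b -> x a = x b -> a = b by move=> *; apply: xy_inj.
have xy'_inj a b : x a = x b -> y' a = y' b -> a = b.
  rewrite /y' => xab yab; apply: xy_inj => //.
  by have := yK a; have := yK b; lia.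
have card1 := quadrant_card xy_inj nouniv p_left p_low.
have card2 : #|[set a | northeast x y' q a]| <= 6 * #|box_lines x y|.
  rewrite -(eq_box_lines (fun a b => box_line_flip x a b yK)).
  by apply: quadrant_card => // a b /nouniv[z zab]; exists z; rewrite box_line_flip.
have card3 := row_card xy_inj nouniv p.
have card4 : #|[set z | x z == x p]| <= #|box_lines x y|.+1.
  rewrite -(eq_box_lines (box_lineC x y)).
  by apply: row_card => // a b /nouniv[z zab]; exists z; rewrite box_lineC.
move: card1 card2 card3 card4.
set A1 := [set a | _]; set A2 := [set a | _]; set A3 := [set a | _].
set A4 := [set a | _] => c1 c2 c3 c4.
(* A point below [p] is also below [q], hence southeast of [q] unless in its column. *)
have sub : [set: V] \subset A1 :|: A2 :|: A3 :|: A4.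
  apply/subsetP=> a _; rewrite !inE /northeast; have := p_left a; have := q_left p.
  have := p_left q; have := q_low p; rewrite /y'.
  by have := yK a; have := yK p; have := yK q; lia.
have cardU := fun A B : {set V} => leq_of_leqif (leq_card_setU A B).
have := subset_leq_card sub; rewrite cardsT.
have := cardU (A1 :|: A2 :|: A3) A4.
have := cardU (A1 :|: A2) A3; have := cardU A1 A2; lia.
Qed.

(** * From the [L_1] metric to ranks of coordinates *)

Local Open Scope ring_scope.

Section Rank.
Variables (R : realType) (T : finType).

Definition rank (f : T -> R) (u : T) : nat := #|[set w | f w < f u]|.

Lemma leq_rank f u v : (rank f u <= rank f v)%N = (f u <= f v).
Proof.
have [le|lt] := lerP (f u) (f v).
  by apply/subset_leq_card/subsetP => w; rewrite !inE => /lt_le_trans->.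
apply/negbTE; rewrite -ltnNge; apply/proper_card/properP; split.
  by apply/subsetP => w; rewrite !inE => /lt_trans->.
by exists v; rewrite !inE ?ltxx.
Qed.


Lemma normr_between (a b c : R) :
  (`|a - b| == `|a - c| + `|c - b|) = ((a <= c <= b) || (b <= c <= a)).
Proof.
apply/eqP/idP => [|/orP[]/andP[? ?]].
- case: (ler0P (a - b)) => ?; case: (ler0P (a - c)) => ?;
    case: (ler0P (c - b)) => ? e; lra.
- by rewrite !ler0_norm; lra.
- by rewrite !ger0_norm; lra.
Qed.

End Rank.

(** The triangle inequality is the sum of those of the two coordinates, so it is an equality exactly
    when both are. *)
Lemma between_l1E (R : realType) (X : {fset R * R}) (a z b : X) :
  between (@l1_on R X) a z b =
  in_box (rank (fun u : X => (val u).1)) (rank (fun u : X => (val u).2)) a z b.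
Proof.
have tri (c d e : R) :
    `|c - d| <= `|c - e| + `|e - d| ?= iff ((c <= e <= d) || (d <= e <= c)).
  by split; [exact: ler_distD | exact: normr_between].
rewrite /between /l1_on /l1_dist addrACA (leifD (tri _ _ _) (tri _ _ _)).
by rewrite /in_box /natbetween !leq_rank.
Qed.

Lemma line_l1E (R : realType) (X : {fset R * R}) (a b : X) :
  line (@l1_on R X) a b =
  box_line (rank (fun u : X => (val u).1)) (rank (fun u : X => (val u).2)) a b.
Proof.
apply/setP => z; rewrite !inE !between_l1E.
have [->|_] := eqVneq z a; first by rewrite in_boxl !orbT.
by have [->|_] := eqVneq z b; first by rewrite in_boxr !orbT.
Qed.

Theorem theorem2 (R : realType) (n : nat) (X : {fset R * R})
    (hn : (2 <= n)%N) (hX : #|` X| = n) :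
  (exists2 L : {set X}, L \in lines (@l1_on R X) & forall x : X, x \in L) \/
  n%:R / 37%:R <= #|lines (@l1_on R X)|%:R :> R.
Proof.
set L := lines _.
have [/existsP[l /andP[lL /forallP]]|nouniv] :=
    boolP [exists l in L, [forall z, z \in l]].
  by left; exists l.
right.
have mem_lines (a b : X) : a != b -> line (@l1_on R X) a b \in L.
  by move=> ab; apply/imsetP; exists (a, b); rewrite ?inE.
have {}nouniv (a b : X) : a != b -> exists z, z \notin line (@l1_on R X) a b.
  move=> ab; apply/existsP; rewrite -negb_forall; apply: contra nouniv => H.
  by apply/existsP; exists (line (@l1_on R X) a b); rewrite H mem_lines.
pose x := rank (fun u : X => (val u).1).
pose y := rank (fun u : X => (val u).2).
have lE : L = box_lines x y by apply: eq_imset => q; apply: line_l1E.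
have rank_inj (f : X -> R) u v : rank f u = rank f v -> f u = f v.
  by move=> e; apply/eqP; rewrite eq_le -!leq_rank e leqnn.
have xy_inj (a b : X) : x a = x b -> y a = y b -> a = b.
  move=> /rank_inj xab /rank_inj yab; apply: val_inj.
  by move: xab yab; case: (val a) (val b) => ? ? [? ?] /= -> ->.
have cX : #|{: X}| = n by rewrite -hX cardfE.
have /card_gt1P[a [b [_ _ ab]]] : (1 < #|{: X}|)%N by rewrite cX.
(* At least one line is needed to absorb the additive 2 into [37 * #|L|]. *)
have L_gt0 : (0 < #|L|)%N.
  by apply/card_gt0P; exists (line (@l1_on R X) a b); apply: mem_lines.
have := @card_le_lines X x y a xy_inj _; rewrite -lE cX => H.
rewrite ler_pdivrMr ?ltr0n // -natrM ler_nat.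
suff : (n <= 14 * #|L| + 2)%N by lia.
by apply: H => c d /nouniv[z]; exists z; rewrite -line_l1E.
Qed.
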